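(* For $\alpha\in S_3$ let $d_n(\emptyset;\alpha)$ be the number of permutations of $\{1,\dots,n\}$ with no fixed points that contain exactly one occurrence of $\alpha$. Call $\alpha,\beta\in S_3$ almost-$D$-Wilf equivalent if $d_n(\emptyset;\alpha)=d_n(\emptyset;\beta)$ for all $n\ge3$. Then there are exactly four almost-$D$-Wilf equivalence classes among the patterns $\alpha\in S_3$.
   Context: An occurrence of $\alpha\in S_3$ in a permutation $\pi=\pi_1\cdots\pi_n$ is a triple of indices $i<j<k$ such that $\pi_i\pi_j\pi_k$ is order-isomorphic to $\alpha$. A fixed point is an index $i$ with $\pi_i=i$. *)

(* Defs.v *)
From mathcomp Require Import all_boot all_fingroup.

Set Implicit Arguments.
Unset Strict Implicit.
Unset Printing Implicit Defensive.

(* A permutation of {1,...,n} is represented by pi : 'S_n acting on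
   'I_n = {0,...,n-1}: positions and values are both shifted by one, which
   changes neither fixed points nor relative order.  Its one-line notation
   is pi 0, pi 1, ..., pi (n-1). *)

Definition order_isomorphic (k : nat) (s t : k.-tuple nat) : bool :=
  [forall a : 'I_k, forall b : 'I_k,
     (tnth s a < tnth s b) == (tnth t a < tnth t b)].

Definition one_line (n : nat) (pi : 'S_n) : n.-tuple nat :=
  [tuple nat_of_ord (pi i) | i < n].

Definition occurrences (n : nat) (alpha : 'S_3) (pi : 'S_n) :
    {set 'I_n * 'I_n * 'I_n} :=
  [set t : 'I_n * 'I_n * 'I_n | let: (i, j, k) := t in
     [&& i < j, j < k &
         order_isomorphic [tuple nat_of_ord (pi i); nat_of_ord (pi j);
                                 nat_of_ord (pi k)]
                          (one_line alpha)]].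

Definition fixed_points (n : nat) (pi : 'S_n) : {set 'I_n} :=
  [set i | pi i == i].

(* d_n(emptyset; alpha) *)
Definition d (n : nat) (alpha : 'S_3) : nat :=
  #|[set pi : 'S_n | (fixed_points pi == set0)
                     && (#|occurrences alpha pi| == 1)]|.

Definition almost_D_Wilf_equivalent (alpha beta : 'S_3) : Prop :=
  forall n : nat, 3 <= n -> d n alpha = d n beta.

Definition is_almost_D_Wilf_class (B : {set 'S_3}) : Prop :=
  exists alpha : 'S_3,
    forall beta : 'S_3, beta \in B <-> almost_D_Wilf_equivalent alpha beta.

(* Main.v *)
Require Import Defs.
From mathcomp Require Import all_boot all_fingroup.

(** Reverse-complement is conjugation by the decreasing permutation; it preserves
    fixed points and exchanges occurrences of a pattern with occurrences of its
    reverse-complement, so 132 ~ 213 and 231 ~ 312.  Conversely, derangements of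
    length 5 separate the rest: d_5 is 14 for 123, 8 for 132 and 213, 6 for 231
    and 312, and 0 for 321. *)

Definition reverse_complement (n : nat) (pi : 'S_n) : 'S_n :=
  (pi ^ perm (@rev_ord_inj n))%g.

Lemma reverse_complementE n (pi : 'S_n) (i : 'I_n) :
  reverse_complement n pi i = rev_ord (pi (rev_ord i)).
Proof.
set w := perm (@rev_ord_inj n).
(* [permJ] evaluates a conjugate at arguments of the form [w x], so [i] is first written as
   [w (rev_ord i)]. *)
have wi : w (rev_ord i) = i by rewrite permE rev_ordK.
by rewrite /reverse_complement -/w -{1}wi permJ permE.
Qed.

Lemma reverse_complement_inj n : injective (reverse_complement n).
Proof. exact: conjg_inj. Qed.

Lemma fixed_points_reverse_complement n (pi : 'S_n) :
  fixed_points (reverse_complement n pi) = @rev_ord n @^-1: fixed_points pi.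
Proof.
apply/setP => i; rewrite !inE reverse_complementE.
by rewrite (can2_eq (@rev_ordK n) (@rev_ordK n)).
Qed.

Lemma ltn_rev_ord n (i j : 'I_n) : (rev_ord i < rev_ord j) = (j < i).
Proof. by rewrite /= ltn_sub2lE. Qed.

Lemma nth_one_line n (pi : 'S_n) (i : 'I_n) : nth 0 (one_line pi) i = pi i.
Proof. by rewrite -tnth_nth tnth_mktuple. Qed.

(** Reversing positions and complementing values turns the comparison of entries [a] and [b] into
    that of entries [rev_ord b] and [rev_ord a]. Both triples undergo this change, so each direction
    instantiates the hypothesis at the reversed indices in swapped order. *)
Lemma order_isomorphic_reverse_complement n (alpha : 'S_3) (x y z : 'I_n) :
  order_isomorphic [tuple val (rev_ord z); val (rev_ord y); val (rev_ord x)]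
                   (one_line (reverse_complement 3 alpha))
  = order_isomorphic [tuple val x; val y; val z] (one_line alpha).
Proof.
have tnth_rev (a : 'I_3) :
    tnth [tuple val (rev_ord z); val (rev_ord y); val (rev_ord x)] a
    = rev_ord (tnth [tuple x; y; z] (rev_ord a)).
  by case: a => [[|[|[|?]]] ?].
have tnth_val (a : 'I_3) :
    tnth [tuple val x; val y; val z] a = tnth [tuple x; y; z] a.
  by case: a => [[|[|[|?]]] ?].
apply/forallP/forallP => H a; apply/forallP => b.
  have /forallP/(_ (rev_ord a)) := H (rev_ord b).
  by rewrite !tnth_rev !tnth_mktuple !reverse_complementE !ltn_rev_ord
    !rev_ordK !tnth_val.
have /forallP/(_ (rev_ord a)) := H (rev_ord b).
by rewrite !tnth_rev !tnth_val !tnth_mktuple !reverse_complementE !ltn_rev_ord.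
Qed.

Lemma in_occurrences n (alpha : 'S_3) (pi : 'S_n) (i j k : 'I_n) :
  ((i, j, k) \in occurrences alpha pi) =
  [&& i < j, j < k & order_isomorphic [tuple val (pi i); val (pi j); val (pi k)]
                                      (one_line alpha)].
Proof. by rewrite inE. Qed.

Lemma card_occurrences_reverse_complement n (alpha : 'S_3) (pi : 'S_n) :
  #|occurrences (reverse_complement 3 alpha) (reverse_complement n pi)|
  = #|occurrences alpha pi|.
Proof.
(* Reversal of positions flips their order, so the triple is also read backwards to stay
   increasing. *)
pose r (t : 'I_n * 'I_n * 'I_n) :=
  let: (i, j, k) := t in (rev_ord k, rev_ord j, rev_ord i).
have rK : involutive r by case=> [[i j] k]; rewrite /r !rev_ordK.
rewrite -[RHS](card_imset _ (inv_inj rK)); congr #|pred_of_set _|.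
apply/setP => t; rewrite -[t]rK (mem_imset _ _ (inv_inj rK)).
case: (r t) => [[i j] k]; rewrite -[r _]/(rev_ord k, rev_ord j, rev_ord i).
rewrite !in_occurrences !ltn_rev_ord !reverse_complementE !rev_ordK.
by rewrite order_isomorphic_reverse_complement andbCA.
Qed.

Lemma d_reverse_complement n (alpha : 'S_3) :
  d n (reverse_complement 3 alpha) = d n alpha.
Proof.
rewrite /d -[RHS](card_imset _ (@reverse_complement_inj n)).
congr #|pred_of_set _|; apply/setP => pi.
have rcK : reverse_complement n (reverse_complement n pi) = pi.
  by apply/permP => i; rewrite !reverse_complementE !rev_ordK.
rewrite -rcK (mem_imset _ _ (@reverse_complement_inj n)) !inE.
rewrite card_occurrences_reverse_complement fixed_points_reverse_complement.
(* Emptiness is compared through cardinalities, which preimages under the bijection [rev_ord]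
   preserve. *)
congr (_ && _); rewrite -!cards_eq0 card_preimset //; exact: rev_ord_inj.
Qed.

Lemma one_line_inj n : injective (fun pi : 'S_n => val (one_line pi)).
Proof.
move=> pi rho eq_line; apply/permP => i; apply/val_inj.
by rewrite /= -!nth_one_line [tval _]eq_line.
Qed.

Lemma mem_one_line n (s : seq nat) :
  s \in permutations (iota 0 n) ->
  exists pi : 'S_n, val (one_line pi) = s.
Proof.
rewrite mem_permutations => s_iota.
have size_s : size s = n by rewrite (perm_size s_iota) size_iota.
have ltsn (i : 'I_n) : nth 0 s i < n.
  have : nth 0 s i \in s by rewrite mem_nth ?size_s.
  by rewrite (perm_mem s_iota) mem_iota.
have s_inj : injective (fun i : 'I_n => Ordinal (ltsn i)).
  move=> i j [] /eqP; rewrite nth_uniq ?size_s //; first by move=> /eqP/val_inj.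
  by rewrite (perm_uniq s_iota) iota_uniq.
exists (perm s_inj); apply: (@eq_from_nth _ 0); first by rewrite size_tuple.
move=> i; rewrite size_tuple => ltin.
by rewrite (nth_one_line _ _ (Ordinal ltin)) permE.
Qed.

Lemma one_line_permutations n (pi : 'S_n) :
  val (one_line pi) \in permutations (iota 0 n).
Proof.
rewrite mem_permutations -val_enum_ord; apply: uniq_perm.
- rewrite map_inj_uniq ?enum_uniq // => i j /val_inj; exact: perm_inj.
- by rewrite map_inj_uniq ?enum_uniq //; exact: val_inj.
move=> x; apply/mapP/mapP => [[i _ ->] | [i _ ->]].
  by exists (pi i); rewrite ?mem_enum.
by exists (pi^-1 i)%g; rewrite ?mem_enum ?permKV.
Qed.

(** This turns a count over ['S_n] into a count over an explicit list, which can be evaluated. *)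
Lemma perm_one_line n :
  perm_eq [seq val (one_line pi) | pi <- enum 'S_n] (permutations (iota 0 n)).
Proof.
apply: uniq_perm; rewrite ?permutations_uniq //.
  by rewrite map_inj_uniq ?enum_uniq //; exact: one_line_inj.
move=> s; apply/mapP/idP => [[pi _ ->] | /mem_one_line [pi <-]].
  exact: one_line_permutations.
by exists pi; rewrite ?mem_enum ?inE.
Qed.

(* [order_iso_seq], [occ_seq], [has_fixed] and [d_seq] are versions of
   [order_isomorphic], [occurrences], [fixed_points] and [d] on one-line
   notations that reduce under [vm_compute]. *)
Definition order_iso_seq (s t : seq nat) : bool :=
  let r := iota 0 3 in
  all (fun a => all (fun b =>
    (nth 0 s a < nth 0 s b) == (nth 0 t a < nth 0 t b)) r) r.
Arguments order_iso_seq : simpl never.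

Lemma order_isomorphic3 (x y z : nat) (t : 3.-tuple nat) :
  order_isomorphic [tuple x; y; z] t = order_iso_seq [:: x; y; z] t.
Proof.
apply/forallP/allP => [H a | H a].
  rewrite mem_iota => a3; apply/allP => b; rewrite mem_iota => b3.
  by move: (H (Ordinal a3)) => /forallP/(_ (Ordinal b3)); rewrite !(tnth_nth 0).
have /H/allP Ha : val a \in iota 0 3 by rewrite mem_iota ltn_ord.
apply/forallP => b; rewrite !(tnth_nth 0).
by apply: Ha; rewrite mem_iota ltn_ord.
Qed.

Definition occ_seq (a s : seq nat) : nat :=
  let r := iota 0 (size s) in
  sumn [seq sumn [seq sumn [seq nat_of_bool [&& i < j, j < k &
    order_iso_seq [:: nth 0 s i; nth 0 s j; nth 0 s k] a]
    | k <- r] | j <- r] | i <- r].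

Definition has_fixed (s : seq nat) : bool :=
  has (fun i => nth 0 s i == i) (iota 0 (size s)).

Definition d_seq (n : nat) (a : seq nat) : nat :=
  count (fun s => ~~ has_fixed s && (occ_seq a s == 1)) (permutations (iota 0 n)).

Lemma sum_ord_sumn n (F : nat -> nat) :
  \sum_(i < n) F i = sumn [seq F i | i <- iota 0 n].
Proof. by rewrite sumnE big_map -[n in iota 0 n]subn0 -/(index_iota 0 n) big_mkord. Qed.

Lemma card_occurrencesE n (alpha : 'S_3) (pi : 'S_n) :
  #|occurrences alpha pi| = occ_seq (one_line alpha) (one_line pi).
Proof.
rewrite /occ_seq size_tuple -sum_ord_sumn -sum1_card big_mkcond /=.
under [RHS]eq_bigr => i _ do rewrite -sum_ord_sumn.
under [RHS]eq_bigr => i _ do under eq_bigr => j _ do rewrite -sum_ord_sumn.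
(* Triples are left-nested pairs: the sums over [i] and [j] are merged first, then joined with the
   one over [k]. *)
rewrite (pair_bigA _ (fun i j => _)) /= (pair_bigA _ (fun p k => _)) /=.
apply: eq_bigr => [[[i j] k]] _; rewrite inE order_isomorphic3 !nth_one_line.
by case: ifP.
Qed.

Lemma has_fixedE n (pi : 'S_n) :
  (fixed_points pi == set0) = ~~ has_fixed (one_line pi).
Proof.
rewrite /has_fixed size_tuple -[LHS]negbK; congr (~~ _).
apply/set0Pn/hasP => [[i] | [i]].
  rewrite inE => /eqP fix_i; exists (val i); first by rewrite mem_iota /=.
  by rewrite nth_one_line fix_i.
rewrite mem_iota /= add0n => ltin; rewrite (nth_one_line _ _ (Ordinal ltin)) => fix_i.
by exists (Ordinal ltin); rewrite inE.
Qed.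

Lemma dE n (alpha : 'S_3) : d n alpha = d_seq n (one_line alpha).
Proof.
rewrite /d_seq -(seq.permP (perm_one_line n)) count_map enumT.
rewrite /d cardE /enum_mem size_filter; apply: eq_count => pi /=.
by rewrite inE has_fixedE card_occurrencesE.
Qed.

(** Storing the counts confines the enumeration of the 120 permutations of length 5 to [d5E]; later
    checks only look up entries. *)
Definition d5_table (a : seq nat) : nat :=
  nth 0 [:: 14; 8; 8; 6; 6; 0]
    (index a [:: [:: 0; 1; 2]; [:: 0; 2; 1]; [:: 1; 0; 2];
                 [:: 1; 2; 0]; [:: 2; 0; 1]; [:: 2; 1; 0]]).

Lemma d5E (alpha : 'S_3) : d 5 alpha = d5_table (one_line alpha).
Proof.
have /allP table : all (fun a => d_seq 5 a == d5_table a) (permutations (iota 0 3)).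
  by vm_compute.
by rewrite dE; apply/eqP/table/one_line_permutations.
Qed.

(** The only repeated table entries, 8 and 6, belong to reverse-complement pairs; this is checked on
    all 36 pairs of patterns. *)
Lemma d5_inj (alpha beta : 'S_3) :
  d 5 alpha = d 5 beta ->
  beta = alpha \/ beta = reverse_complement 3 alpha.
Proof.
(* With values 0, 1, 2 the complement is [2 - x], which makes the symmetry computable on
   sequences. *)
have one_line_rc : val (one_line (reverse_complement 3 alpha))
    = [seq 2 - x | x <- rev (one_line alpha)].
  apply: (@eq_from_nth _ 0); first by rewrite size_map size_rev !size_tuple.
  move=> i; rewrite size_tuple => lti3.
  rewrite (nth_one_line _ _ (Ordinal lti3)) reverse_complementE.
  rewrite (nth_map 0) ?size_rev ?size_tuple // nth_rev ?size_tuple //.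
  by rewrite (nth_one_line _ _ (rev_ord (Ordinal lti3))).
have d5_separates :
    all (fun a => all (fun b => (d5_table a == d5_table b) ==>
      ((b == a) || (b == [seq 2 - x | x <- rev a]))) (permutations (iota 0 3)))
    (permutations (iota 0 3)) by vm_compute.
rewrite !d5E => /eqP d5_eq.
have /allP/(_ _ (one_line_permutations _ beta)) :=
  allP d5_separates _ (one_line_permutations _ alpha).
rewrite d5_eq -one_line_rc => /orP [] /eqP eq_line; [left | right];
  exact: one_line_inj eq_line.
Qed.

(** Length 5 decides everything: equal counts there leave only equal or reverse-complement patterns,
    whose counts agree at every length. *)
Lemma almost_D_Wilf_equivalentE (alpha beta : 'S_3) :
  almost_D_Wilf_equivalent alpha beta <-> d 5 alpha = d 5 beta.
Proof.
split=> [-> // | /d5_inj [] -> n _ //]; by rewrite d_reverse_complement.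
Qed.

Lemma d5_mem (alpha : 'S_3) : d 5 alpha \in [tuple 0; 6; 8; 14].
Proof.
have /allP : all (fun a => d5_table a \in [:: 0; 6; 8; 14]) (permutations (iota 0 3)).
  by vm_compute.
by rewrite d5E; apply; exact: one_line_permutations.
Qed.

Lemma d5_surj (v : nat) :
  v \in [tuple 0; 6; 8; 14] -> exists alpha : 'S_3, d 5 alpha = v.
Proof.
have /allP d5_onto : all (fun v => has (fun a => d5_table a == v)
    (permutations (iota 0 3))) [:: 0; 6; 8; 14] by vm_compute.
move=> /d5_onto /hasP [a /mem_one_line [alpha <-] /eqP <-].
by exists alpha; rewrite d5E.
Qed.

Theorem theorem6p4 :
  exists classes : {set {set 'S_3}},
    (forall B : {set 'S_3}, B \in classes <-> is_almost_D_Wilf_class B)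
    /\ #|classes| = 4.
Proof.
pose t := [tuple 0; 6; 8; 14].
(* The classes are the fibres of [d 5], indexed by position in the list of its values. *)
pose C (v : 'I_4) := [set beta : 'S_3 | d 5 beta == tnth t v].
exists [set C v | v : 'I_4]; split.
  move=> B; split=> [/imsetP [v _ ->] | [alpha alphaB]].
    have [alpha d_alpha] := d5_surj _ (mem_tnth v t).
    exists alpha => beta; rewrite inE -d_alpha eq_sym.
    by split=> [/eqP | ] /almost_D_Wilf_equivalentE // => ->.
  have /tnthP [v d_alpha] := d5_mem alpha.
  apply/imsetP; exists v => //; apply/setP => beta; rewrite inE -d_alpha.
  by apply/idP/eqP => [/alphaB | /esym] /almost_D_Wilf_equivalentE // /alphaB.
(* Every fibre is nonempty, so two equal fibres share a pattern whose count is both [tnth t v] and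
   [tnth t w]; the entries of [t] being distinct, [v = w]. *)
rewrite card_imset ?card_ord // => v w eqC.
have [alpha d_alpha] := d5_surj _ (mem_tnth v t).
have : alpha \in C v by rewrite inE d_alpha.
rewrite eqC inE d_alpha => /eqP.
by apply/tuple_uniqP.
Qed.
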